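(* Let $f:\mathbb{R}^{2n}\to\mathbb{R}$ be the penalized placement objective $$f(z)=\operatorname{HPWL}(z)+\sum_{i=1}^n\gamma_i\,\ell_b(x_i,y_i)+\sum_{1\le i<j\le n}\gamma_{ij}\,\ell_{xy}(x_i,y_i,x_j,y_j)$$ defined in the context, and let $M=\max_{e\in E}\#e$, where $\#e$ denotes the number of elements of the net $e$. Then $f$ can be formulated as a deep neural network with $\max\{\lceil\log_2 M\rceil+1,\,3\}$ ReLU layers.
   Context: Placement data: $V=\{v_1,\dots,v_n\}$ is a finite set of cells; cell $v_i$ is a rectangle of width $w_i>0$ and height $h_i>0$ with center $(x_i,y_i)\in\mathbb{R}^2$. $E=\{e_1,\dots,e_m\}$ is a finite set of nets, each net being a nonempty subset of $V$. The placement region is the rectangle with lower left corner $(0,0)$ and upper right corner $(W,H)$. Write $z=(x,y)$ with $x=(x_1,\dots,x_n)$, $y=(y_1,\dots,y_n)$, regarded as an element of $\mathbb{R}^{2n}$. $\operatorname{ReLU}(t)=\max(0,t)$ for $t\in\mathbb{R}$ (applied coordinatewise to vectors). Half-perimeter wirelength: $\operatorname{HPWL}(z)=\sum_{e\in E}\bigl(\max_{v_i,v_j\in e}|x_i-x_j|+\max_{v_i,v_j\in e}|y_i-y_j|\bigr)$. Boundary penalty: $\ell_b(x_i,y_i)=\operatorname{ReLU}(\tfrac{w_i}{2}-x_i)+\operatorname{ReLU}(x_i-w_i^+)+\operatorname{ReLU}(\tfrac{h_i}{2}-y_i)+\operatorname{ReLU}(y_i-h_i^+)$, where $w_i^+=W-w_i/2$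 and $h_i^+=H-h_i/2$. Overlap penalty: for $r,t>0$ define $\varphi_{r,t}:\mathbb{R}^2\to\mathbb{R}$ by $\varphi_{r,t}(x,y)=0$ if $|x|\ge r$ or $|y|\ge t$; $\varphi_{r,t}(x,y)=1-|x|/r$ if $|y|/t\le|x|/r<1$; $\varphi_{r,t}(x,y)=1-|y|/t$ if $|x|/r<|y|/t<1$. Then $\ell_{xy}(x_i,y_i,x_j,y_j)=\varphi_{w_{ij},h_{ij}}(x_i-x_j,\,y_i-y_j)$ with $w_{ij}=\frac{w_i+w_j}{2}$, $h_{ij}=\frac{h_i+h_j}{2}$. The $\gamma_i>0$ and $\gamma_{ij}>0$ are fixed real penalty parameters. A deep neural network with $k$ ReLU layers is a function of the form $A_k\circ\operatorname{ReLU}\circ A_{k-1}\circ\cdots\circ\operatorname{ReLU}\circ A_0$, where $A_0,\dots,A_k$ are affine maps between finite-dimensional real vector spaces (arbitrary layer widths allowed) and $\operatorname{ReLU}$, applied coordinatewise, occurs $k$ times. *)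

(* Defs.v *)
From HB Require Import structures.
From mathcomp Require Import all_boot all_order all_algebra.
From mathcomp Require Import reals.

Set Implicit Arguments.
Unset Strict Implicit.
Unset Printing Implicit Defensive.

Import Order.TTheory GRing.Theory Num.Theory.
Local Open Scope ring_scope.

Definition relu {R : realType} (t : R) : R := Num.max 0 t.

Definition relu_vec {R : realType} {d : nat} (u : 'cV[R]_d) : 'cV[R]_d :=
  map_mx relu u.

Definition is_affine {R : realType} {p q : nat}
    (g : 'cV[R]_p -> 'cV[R]_q) : Prop :=
  exists (A : 'M[R]_(q, p)) (b : 'cV[R]_q), forall u, g u = A *m u + b.

(* [is_relu_dnn k g]: g = A_k o ReLU o A_(k-1) o ... o ReLU o A_0 with affine
   A_0, ..., A_k of arbitrary widths and exactly k occurrences of ReLU; the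
   recursion peels off the input side ReLU o A_0. *)
Fixpoint is_relu_dnn {R : realType} (k p q : nat)
    (g : 'cV[R]_p -> 'cV[R]_q) : Prop :=
  match k with
  | 0 => is_affine g
  | k'.+1 => exists (r : nat) (A0 : 'cV[R]_p -> 'cV[R]_r)
               (g' : 'cV[R]_r -> 'cV[R]_q),
      [/\ is_affine A0, is_relu_dnn k' g'
        & forall u, g u = g' (relu_vec (A0 u))]
  end.

(* Scalar-valued functions are identified with maps into 'cV_1. *)
Definition scalar_relu_dnn {R : realType} (k d : nat)
    (f : 'cV[R]_d -> R) : Prop :=
  is_relu_dnn k (fun u => \col_(_ < 1) f u).

(* A placement is z = (x, y) in 'cV_(n + n): x is the upper half of z and y the
   lower half. *)
Definition xcoord {R : realType} {n : nat} (z : 'cV[R]_(n + n)) (i : 'I_n) : R :=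
  usubmx z i 0.

Definition ycoord {R : realType} {n : nat} (z : 'cV[R]_(n + n)) (i : 'I_n) : R :=
  dsubmx z i 0.

(* The largest |u_i - u_j| over i, j in e; starting the maximum at 0 is harmless
   because the values are nonnegative. *)
Definition spread {R : realType} {n : nat} (e : {set 'I_n}) (u : 'I_n -> R) : R :=
  \big[Num.max/0]_(i in e) \big[Num.max/0]_(j in e) `|u i - u j|.

Definition HPWL {R : realType} {n : nat} (E : {set {set 'I_n}})
    (z : 'cV[R]_(n + n)) : R :=
  \sum_(e in E) (spread e (xcoord z) + spread e (ycoord z)).

Definition boundary_penalty {R : realType} (W H wi hi xi yi : R) : R :=
  relu (wi / 2 - xi) + relu (xi - (W - wi / 2))
  + relu (hi / 2 - yi) + relu (yi - (H - hi / 2)).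

Definition phi {R : realType} (r t x y : R) : R :=
  if (r <= `|x|) || (t <= `|y|) then 0
  else if `|y| / t <= `|x| / r then 1 - `|x| / r
  else 1 - `|y| / t.

Definition overlap_penalty {R : realType} (wi hi wj hj xi yi xj yj : R) : R :=
  phi ((wi + wj) / 2) ((hi + hj) / 2) (xi - xj) (yi - yj).

Definition objective {R : realType} {n : nat} (w h : 'I_n -> R)
    (E : {set {set 'I_n}}) (W H : R) (gb : 'I_n -> R) (go : 'I_n -> 'I_n -> R)
    (z : 'cV[R]_(n + n)) : R :=
  HPWL E z
  + \sum_(i < n) gb i * boundary_penalty W H (w i) (h i) (xcoord z i) (ycoord z i)
  + \sum_(i < n) \sum_(j < n | (i < j)%N)
      go i j * overlap_penalty (w i) (h i) (w j) (h j)
                 (xcoord z i) (ycoord z i) (xcoord z j) (ycoord z j).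

(* For E = set0 the maximum is 0 by convention. *)
Definition max_net_size {n : nat} (E : {set {set 'I_n}}) : nat :=
  \max_(e in E) #|e|.

(* Main.v *)
Require Import Defs.
From HB Require Import structures.
From mathcomp Require Import all_boot all_order all_algebra.
From mathcomp Require Import reals.
From mathcomp Require Import lra.

Set Implicit Arguments.
Unset Strict Implicit.
Unset Printing Implicit Defensive.

Import Order.TTheory GRing.Theory Num.Theory.
Local Open Scope ring_scope.

(** The spread of a net is [max u_i + max (- u_i)], and a maximum of at most
    [2 ^ k] affine functions needs [k] ReLU layers by pairing, using
    [max a b = b + ReLU (a - b)].  The overlap penalty is
    [ReLU (1 - max (|x| / r) (|y| / t))]: one layer for the absolute values, one
    for the maximum and one for the outer ReLU.  A network can be deepened by
    any number of layers through [a = ReLU a - ReLU (- a)], so all summands can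
    be brought to the same depth and run in parallel. *)

(** * Composition and stacking of vector-valued networks *)

Lemma is_affine_comp (R : realType) (p q r : nat) (B : 'cV[R]_q -> 'cV[R]_r)
    (A : 'cV[R]_p -> 'cV[R]_q) :
  is_affine B -> is_affine A -> is_affine (B \o A).
Proof.
move=> [MB [b hB]] [MA [a hA]]; exists (MB *m MA), (MB *m a + b) => u /=.
by rewrite hB hA mulmxDr mulmxA addrA.
Qed.

Lemma is_affine_parallel (R : realType) (p1 p2 q1 q2 : nat)
    (A1 : 'cV[R]_p1 -> 'cV[R]_q1) (A2 : 'cV[R]_p2 -> 'cV[R]_q2) :
  is_affine A1 -> is_affine A2 ->
  is_affine (fun u : 'cV[R]_(p1 + p2) => col_mx (A1 (usubmx u)) (A2 (dsubmx u))).
Proof.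
move=> [M1 [b1 h1]] [M2 [b2 h2]].
exists (block_mx M1 0 0 M2), (col_mx b1 b2) => u.
by rewrite -{3}[u]vsubmxK mul_block_col !mul0mx addr0 add0r add_col_mx h1 h2.
Qed.

Lemma relu_dnn_ext (R : realType) (k p q : nat) (g g' : 'cV[R]_p -> 'cV[R]_q) :
  g =1 g' -> is_relu_dnn k g -> is_relu_dnn k g'.
Proof.
move=> gg'; case: k => [|k] /=.
  by move=> [A [b h]]; exists A, b => u; rewrite -gg'.
by move=> [r [A0 [t [hA ht h]]]]; exists r, A0, t; split=> // u; rewrite -gg'.
Qed.

(** The inner affine map merges with [A_0], so the depth does not change. *)
Lemma relu_dnn_comp_affine (R : realType) (k p q r : nat)
    (g : 'cV[R]_q -> 'cV[R]_r) (A : 'cV[R]_p -> 'cV[R]_q) :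
  is_affine A -> is_relu_dnn k g -> is_relu_dnn k (g \o A).
Proof.
move=> hA; case: k => [|k] /=; first by move=> hg; apply: is_affine_comp.
move=> [s [A0 [g' [hA0 hg' h]]]]; exists s, (A0 \o A), g'; split=> //.
exact: is_affine_comp.
Qed.

(** The outer affine map merges with [A_k]. Since [is_relu_dnn] peels layers off the input side,
    reaching [A_k] takes an induction on the depth. *)
Lemma affine_comp_relu_dnn (R : realType) (k p q r : nat)
    (B : 'cV[R]_q -> 'cV[R]_r) (g : 'cV[R]_p -> 'cV[R]_q) :
  is_affine B -> is_relu_dnn k g -> is_relu_dnn k (B \o g).
Proof.
move=> hB; elim: k p g => [|k IHk] p g /=; first exact: is_affine_comp.
move=> [s [A0 [g' [hA0 hg' h]]]]; exists s, A0, (B \o g'); split=> //.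
- exact: IHk.
- by move=> u /=; rewrite h.
Qed.

Lemma relu_dnn_relu (R : realType) (k p q : nat) (g : 'cV[R]_p -> 'cV[R]_q) :
  is_relu_dnn k g -> is_relu_dnn k.+1 (relu_vec \o g).
Proof.
elim: k p g => [|k IHk] p g.
  (* The affine [g] feeds the new ReLU layer, and the identity serves as the last affine map. *)
  move=> hg; exists q, g, id; split=> //.
  by exists 1%:M, 0 => u; rewrite mul1mx addr0.
move=> [s [A0 [g' [hA0 hg' h]]]]; exists s, A0, (relu_vec \o g'); split=> //.
- exact: IHk.
- by move=> u /=; rewrite h.
Qed.

(** Two networks of equal depth run side by side layer by layer: affine maps combine
    block-diagonally, and the coordinatewise ReLU commutes with [col_mx]. *)
Lemma relu_dnn_parallel (R : realType) (k p1 p2 q1 q2 : nat)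
    (g1 : 'cV[R]_p1 -> 'cV[R]_q1) (g2 : 'cV[R]_p2 -> 'cV[R]_q2) :
  is_relu_dnn k g1 -> is_relu_dnn k g2 ->
  is_relu_dnn k
    (fun u : 'cV[R]_(p1 + p2) => col_mx (g1 (usubmx u)) (g2 (dsubmx u))).
Proof.
elim: k p1 p2 g1 g2 => [|k IHk] p1 p2 g1 g2 /=; first exact: is_affine_parallel.
move=> [s1 [A1 [g1' [hA1 hg1 h1]]]] [s2 [A2 [g2' [hA2 hg2 h2]]]].
exists (s1 + s2)%N, (fun u => col_mx (A1 (usubmx u)) (A2 (dsubmx u))),
  (fun u => col_mx (g1' (usubmx u)) (g2' (dsubmx u))); split.
- exact: is_affine_parallel.
- exact: IHk.
- by move=> u; rewrite /relu_vec map_col_mx col_mxKu col_mxKd h1 h2.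
Qed.

Lemma relu_dnn_col_mx (R : realType) (k p q1 q2 : nat)
    (g1 : 'cV[R]_p -> 'cV[R]_q1) (g2 : 'cV[R]_p -> 'cV[R]_q2) :
  is_relu_dnn k g1 -> is_relu_dnn k g2 ->
  is_relu_dnn k (fun u => col_mx (g1 u) (g2 u)).
Proof.
move=> h1 h2.
(* Both networks read the same input, which an affine map first duplicates. *)
have dup : is_affine (fun u : 'cV[R]_p => col_mx u u).
  exists (col_mx 1%:M 1%:M), 0 => u.
  by rewrite mul_col_mx mul1mx addr0.
apply: relu_dnn_ext (relu_dnn_comp_affine dup (relu_dnn_parallel h1 h2)) => u /=.
by rewrite col_mxKu col_mxKd.
Qed.

(** * Closure properties of scalar networks *)

Section ScalarNetworks.
Variables (R : realType) (d : nat).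
Implicit Types (k : nat) (f g : 'cV[R]_d -> R).

Lemma scalar_relu_dnn_ext k f g :
  f =1 g -> scalar_relu_dnn k f -> scalar_relu_dnn k g.
Proof. by move=> fg; apply: relu_dnn_ext => u; apply/colP => i; rewrite !mxE. Qed.

(** Stacking the two outputs and applying one affine map costs no layer. Sums, scalings and
    negations all reduce to this, the unary ones by taking [g := f] with coefficient 0. *)
Lemma scalar_relu_dnn_lincomb k f g (a b c : R) :
  scalar_relu_dnn k f -> scalar_relu_dnn k g ->
  scalar_relu_dnn k (fun u => a * f u + b * g u + c).
Proof.
move=> hf hg.
have hB : is_affine (fun v : 'cV[R]_(1 + 1) =>
    row_mx a%:M b%:M *m v + const_mx c : 'cV[R]_1).
  by exists (row_mx a%:M b%:M), (const_mx c).
apply: relu_dnn_ext (affine_comp_relu_dnn hB (relu_dnn_col_mx hf hg)) => u /=.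
by rewrite mul_row_col !mul_scalar_mx; apply/colP => i; rewrite !mxE.
Qed.

Lemma scalar_relu_dnn_relu k f :
  scalar_relu_dnn k f -> scalar_relu_dnn k.+1 (fun u => relu (f u)).
Proof.
move=> hf; apply: relu_dnn_ext (relu_dnn_relu hf) => u /=.
by apply/colP => i; rewrite !mxE.
Qed.

Lemma relu_sub_reluN (t : R) : relu t - relu (- t) = t.
Proof. by rewrite /relu /Num.max; case: ifP; case: ifP; lra. Qed.

Lemma max_relu (s t : R) : Num.max s t = t + relu (s - t).
Proof. by rewrite /relu /Num.max; case: ifP; case: ifP; lra. Qed.

Lemma scalar_relu_dnnS k f : scalar_relu_dnn k f -> scalar_relu_dnn k.+1 f.
Proof.
move=> hf; have hN := scalar_relu_dnn_lincomb (- 1) 0 0 hf hf.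
apply: scalar_relu_dnn_ext (scalar_relu_dnn_lincomb 1 (- 1) 0
  (scalar_relu_dnn_relu hf) (scalar_relu_dnn_relu hN)) => u.
by rewrite -[RHS]relu_sub_reluN !mulN1r mul0r !addr0 mul1r.
Qed.

Lemma scalar_relu_dnn_leq k l f :
  (k <= l)%N -> scalar_relu_dnn k f -> scalar_relu_dnn l f.
Proof.
move=> /subnK <-; elim: (l - k)%N => // m IHm /IHm.
by rewrite addSn; apply: scalar_relu_dnnS.
Qed.

Lemma scalar_relu_dnn_max k f g :
  scalar_relu_dnn k f -> scalar_relu_dnn k g ->
  scalar_relu_dnn k.+1 (fun u => Num.max (f u) (g u)).
Proof.
move=> hf hg; have hfg := scalar_relu_dnn_lincomb 1 (- 1) 0 hf hg.
(* While [f - g] passes through the new ReLU, [g] must be carried unchanged through the same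
   layer. *)
apply: scalar_relu_dnn_ext (scalar_relu_dnn_lincomb 1 1 0
  (scalar_relu_dnnS hg) (scalar_relu_dnn_relu hfg)) => u.
by rewrite max_relu !mul1r !addr0 mulN1r.
Qed.

Lemma scalar_relu_dnn_cst k (c : R) :
  scalar_relu_dnn k (fun _ : 'cV[R]_d => c).
Proof.
apply: (@scalar_relu_dnn_leq 0) => //; exists 0, (const_mx c) => u.
by rewrite mul0mx add0r; apply/colP => i; rewrite !mxE.
Qed.

Lemma scalar_relu_dnn_coord k (i : 'I_d) :
  scalar_relu_dnn k (fun u : 'cV[R]_d => u i 0).
Proof.
apply: (@scalar_relu_dnn_leq 0) => //; exists (delta_mx 0 i), 0 => u.
by rewrite -rowE addr0; apply/colP => j; rewrite !mxE.
Qed.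

Lemma scalar_relu_dnnD k f g :
  scalar_relu_dnn k f -> scalar_relu_dnn k g ->
  scalar_relu_dnn k (fun u => f u + g u).
Proof.
move=> hf hg; apply: scalar_relu_dnn_ext (scalar_relu_dnn_lincomb 1 1 0 hf hg).
by move=> u; rewrite !mul1r addr0.
Qed.

Lemma scalar_relu_dnnZ k (a : R) f :
  scalar_relu_dnn k f -> scalar_relu_dnn k (fun u => a * f u).
Proof.
move=> hf; apply: scalar_relu_dnn_ext (scalar_relu_dnn_lincomb a 0 0 hf hf).
by move=> u; rewrite mul0r !addr0.
Qed.

Lemma scalar_relu_dnnN k f :
  scalar_relu_dnn k f -> scalar_relu_dnn k (fun u => - f u).
Proof.
move=> /(scalar_relu_dnnZ (- 1)); apply: scalar_relu_dnn_ext => u.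
by rewrite mulN1r.
Qed.

Lemma scalar_relu_dnnB k f g :
  scalar_relu_dnn k f -> scalar_relu_dnn k g ->
  scalar_relu_dnn k (fun u => f u - g u).
Proof. by move=> hf /scalar_relu_dnnN; apply: scalar_relu_dnnD. Qed.

Lemma scalar_relu_dnn_sum k (I : Type) (r : seq I) (P : pred I)
    (F : I -> 'cV[R]_d -> R) :
  (forall i, P i -> scalar_relu_dnn k (F i)) ->
  scalar_relu_dnn k (fun u => \sum_(i <- r | P i) F i u).
Proof.
move=> hF; elim: r => [|i r IHr].
  apply: scalar_relu_dnn_ext (scalar_relu_dnn_cst k 0) => u.
  by rewrite big_nil.
have [Pi|nPi] := boolP (P i).
  apply: scalar_relu_dnn_ext (scalar_relu_dnnD (hF i Pi) IHr) => u.
  by rewrite big_cons Pi.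
by apply: scalar_relu_dnn_ext IHr => u; rewrite big_cons (negPf nPi).
Qed.

Lemma scalar_relu_dnn_abs k f :
  scalar_relu_dnn k f -> scalar_relu_dnn k.+1 (fun u => `|f u|).
Proof.
move=> hf; have := scalar_relu_dnn_max hf (scalar_relu_dnnN hf).
by apply: scalar_relu_dnn_ext => u; rewrite maxrN.
Qed.

(* The maximum is specified by its order properties rather than as a [\big],
   which would need a least element. *)
Lemma scalar_relu_dnn_bigmax l k (I : eqType) (s : seq I)
    (F : I -> 'cV[R]_d -> R) :
  (0 < size s <= 2 ^ k)%N -> (forall i, scalar_relu_dnn l (F i)) ->
  exists2 g, scalar_relu_dnn (k + l) g &
    forall u, (forall i, i \in s -> F i u <= g u) /\
              (exists2 i, i \in s & g u = F i u).
Proof.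
move=> hs hF; elim: k s hs => [|k IHk] s.
  case: s => [|i [|j s]] // _; exists (F i) => // u; split.
    by move=> j; rewrite inE => /eqP ->.
  by exists i; rewrite ?mem_head.
(* A short list is padded by one layer; splitting it at [2 ^ k] would leave an empty second half,
   which has no maximum. *)
case/andP=> s_gt0 s_le; have [s_small|s_big] := leqP (size s) (2 ^ k).
  have [|g hg gP] := IHk s; first by rewrite s_gt0.
  by exists g => //; apply: scalar_relu_dnnS.
have [|g1 hg1 g1P] := IHk (take (2 ^ k) s).
  by rewrite size_take s_big expn_gt0 leqnn.
have [|g2 hg2 g2P] := IHk (drop (2 ^ k) s).
  by rewrite size_drop subn_gt0 s_big leq_subLR addnn -mul2n -expnS.
exists (fun u => Num.max (g1 u) (g2 u)); first exact: scalar_relu_dnn_max.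
move=> u; have [ub1 [i1 i1s e1]] := g1P u; have [ub2 [i2 i2s e2]] := g2P u.
split=> [i|].
  rewrite -{1}(cat_take_drop (2 ^ k) s) mem_cat le_max.
  by case/orP=> [/ub1|/ub2] ->; rewrite ?orbT.
case: (leP (g1 u) (g2 u)) => _; [exists i2|exists i1] => //.
- exact: mem_drop i2s.
- exact: mem_take i1s.
Qed.

End ScalarNetworks.

(** * Spread of a net and the overlap function as networks *)

Lemma spread_eq (R : realType) (n : nat) (e : {set 'I_n}) (v : 'I_n -> R)
    (a b : 'I_n) :
  a \in e -> b \in e -> (forall i, i \in e -> v i <= v a) ->
  (forall i, i \in e -> v b <= v i) -> spread e v = v a - v b.
Proof.
move=> ae be ub lb; apply/eqP; rewrite eq_le /spread; apply/andP; split.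
  (* The bound must also dominate the default value 0 of both iterated maxima. *)
  have ge0 : 0 <= v a - v b by rewrite subr_ge0 ub.
  apply: bigmax_le => // i ie; apply: bigmax_le => // j je.
  have := ub i ie; have := ub j je; have := lb i ie; have := lb j je.
  by move=> *; rewrite ler_norml; apply/andP; split; lra.
apply: le_trans (ler_norm _) _.
(* Conversely, the pair [(a, b)] is one of the pairs over which the maximum runs. *)
apply: le_trans (le_bigmax_cond _ (fun i => \big[Num.max/0]_(j in e) `|v i - v j|) ae).
exact: (le_bigmax_cond _ (fun j => `|v a - v j|)).
Qed.

Lemma scalar_relu_dnn_spread (R : realType) (n d k : nat) (e : {set 'I_n})
    (F : 'cV[R]_d -> 'I_n -> R) :
  e != set0 -> (#|e| <= 2 ^ k)%N ->
  (forall i, scalar_relu_dnn 0 (fun u => F u i)) ->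
  scalar_relu_dnn k (fun u => spread e (F u)).
Proof.
move=> e0 ek hF.
have he : (0 < size (enum e) <= 2 ^ k)%N by rewrite -cardE card_gt0 e0.
have [gM hM MP] := scalar_relu_dnn_bigmax (F := fun i u => F u i) he hF.
(* The maximum of the negated coordinates is minus their minimum, so [gM + gm] is maximum minus
   minimum. *)
have [gm hm mP] := scalar_relu_dnn_bigmax (F := fun i u => - F u i) he
  (fun i => scalar_relu_dnnN (hF i)).
rewrite -[k]addn0; apply: scalar_relu_dnn_ext (scalar_relu_dnnD hM hm) => u.
have [ubM [a ae aE]] := MP u; have [ubm [b be bE]] := mP u.
rewrite aE bE; apply/esym/spread_eq; rewrite -?(mem_enum e) //= => i.
  by rewrite -(mem_enum e) -aE; apply: ubM.
by rewrite -(mem_enum e) -[_ <= _]lerN2 -bE; apply: ubm.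
Qed.

(** After dividing by [r] and [t], the zero region is where the larger quotient is at least 1, which
    is where the ReLU vanishes; elsewhere [phi] is 1 minus the larger quotient. *)
Lemma phi_relu (R : realType) (r t x y : R) : 0 < r -> 0 < t ->
  phi r t x y = relu (1 - Num.max (`|x| / r) (`|y| / t)).
Proof.
move=> r0 t0; rewrite /phi /relu.
have -> : (r <= `|x|) = (1 <= `|x| / r) by rewrite ler_pdivlMr // mul1r.
have -> : (t <= `|y|) = (1 <= `|y| / t) by rewrite ler_pdivlMr // mul1r.
move: (`|x| / r) (`|y| / t) => a b.
case: (leP 1 a) => ha; case: (leP 1 b) => hb; case: (leP b a) => hab /=;
  case: leP; lra.
Qed.

Lemma scalar_relu_dnn_phi (R : realType) (d k : nat) (r t : R)
    (f g : 'cV[R]_d -> R) : 0 < r -> 0 < t ->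
  scalar_relu_dnn k f -> scalar_relu_dnn k g ->
  scalar_relu_dnn k.+3 (fun u => phi r t (f u) (g u)).
Proof.
move=> r0 t0 hf hg.
have ha := scalar_relu_dnnZ r^-1 (scalar_relu_dnn_abs hf).
have hb := scalar_relu_dnnZ t^-1 (scalar_relu_dnn_abs hg).
have := scalar_relu_dnn_relu
  (scalar_relu_dnnB (scalar_relu_dnn_cst d _ 1) (scalar_relu_dnn_max ha hb)).
by apply: scalar_relu_dnn_ext => u; rewrite phi_relu // ![_^-1 * _]mulrC.
Qed.

(** * The terms of the objective and their assembly *)

Lemma scalar_relu_dnn_xcoord (R : realType) (n k : nat) (i : 'I_n) :
  scalar_relu_dnn k (fun z : 'cV[R]_(n + n) => xcoord z i).
Proof.
apply: scalar_relu_dnn_ext (scalar_relu_dnn_coord R k (lshift n i)) => z.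
by rewrite /xcoord mxE.
Qed.

Lemma scalar_relu_dnn_ycoord (R : realType) (n k : nat) (i : 'I_n) :
  scalar_relu_dnn k (fun z : 'cV[R]_(n + n) => ycoord z i).
Proof.
apply: scalar_relu_dnn_ext (scalar_relu_dnn_coord R k (rshift n i)) => z.
by rewrite /ycoord mxE.
Qed.

Lemma scalar_relu_dnn_HPWL (R : realType) (n k : nat) (E : {set {set 'I_n}}) :
  (forall e, e \in E -> e != set0) -> (max_net_size E <= 2 ^ k)%N ->
  scalar_relu_dnn k (@HPWL R n E).
Proof.
move=> nets_nonempty Ek; apply: scalar_relu_dnn_sum => e eE.
have ek : (#|e| <= 2 ^ k)%N.
  apply: leq_trans Ek.
  exact: (@leq_bigmax_cond _ (mem E) (fun e : {set 'I_n} => #|e|)).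
have e0 := nets_nonempty e eE.
apply: scalar_relu_dnnD; apply: scalar_relu_dnn_spread => // i.
- exact: scalar_relu_dnn_xcoord.
- exact: scalar_relu_dnn_ycoord.
Qed.

Lemma scalar_relu_dnn_boundary (R : realType) (d k : nat) (W H wi hi : R)
    (f g : 'cV[R]_d -> R) :
  scalar_relu_dnn k f -> scalar_relu_dnn k g ->
  scalar_relu_dnn k.+1 (fun u => boundary_penalty W H wi hi (f u) (g u)).
Proof.
move=> hf hg; do ![apply: scalar_relu_dnnD]; apply: scalar_relu_dnn_relu;
  by apply: scalar_relu_dnnB => //; apply: scalar_relu_dnn_cst.
Qed.

Theorem theorem1 (R : realType) (n : nat) (w h : 'I_n -> R)
    (E : {set {set 'I_n}}) (W H : R)
    (gb : 'I_n -> R) (go : 'I_n -> 'I_n -> R)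
    (w_gt0 : forall i, 0 < w i) (h_gt0 : forall i, 0 < h i)
    (nets_nonempty : forall e, e \in E -> e != set0)
    (gb_gt0 : forall i, 0 < gb i)
    (go_gt0 : forall i j : 'I_n, (i < j)%N -> 0 < go i j) :
  scalar_relu_dnn (maxn (up_log 2 (max_net_size E) + 1) 3)
    (objective w h E W H gb go).
Proof.
set k := maxn _ _.
have k3 : (3 <= k)%N by rewrite leq_maxr.
apply: scalar_relu_dnnD; first apply: scalar_relu_dnnD.
- apply: (@scalar_relu_dnn_leq _ _ (up_log 2 (max_net_size E))).
    by rewrite leq_max addn1 leqnSn.
  (* [up_log 2 M] is the ceiling of the binary logarithm, so [up_logP] bounds every net size by the
     power of two that the pairing requires. *)
  by apply: scalar_relu_dnn_HPWL => //; apply: up_logP.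
- apply: scalar_relu_dnn_sum => i _; apply: scalar_relu_dnnZ.
  apply: (@scalar_relu_dnn_leq _ _ 1); first exact: leq_trans k3.
  apply: scalar_relu_dnn_boundary.
    exact: scalar_relu_dnn_xcoord.
  exact: scalar_relu_dnn_ycoord.
apply: scalar_relu_dnn_sum => i _; apply: scalar_relu_dnn_sum => j _.
(* The overlap terms take three layers on affine inputs; this is the source of the 3 in the
   depth. *)
apply: scalar_relu_dnnZ; apply: (scalar_relu_dnn_leq k3).
apply: scalar_relu_dnn_phi; rewrite ?divr_gt0 ?addr_gt0 //.
- by apply: scalar_relu_dnnB; apply: scalar_relu_dnn_xcoord.
- by apply: scalar_relu_dnnB; apply: scalar_relu_dnn_ycoord.
Qed.
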